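(* Let $k,m$ be integers with $0<k<m$, let $u$ be the solution of the second order elliptic variational problem: find $u\in V$ with $a(u,v)=l(v)$ for all $v\in V$, and for $i=k$ or $i=m$ let $u_h^{(i)}$ be the corresponding $P_i$ Lagrange finite element approximation of $u$ with mesh size $h>0$. Let $X^{(i)}(h)=\|u_h^{(i)}-u\|_{1,\Omega}$ be the associated approximation-error random variables, and assume that $X^{(k)}(h)$ and $X^{(m)}(h)$ are independent and that each $X^{(i)}(h)$ is uniformly distributed on $[0,C_i h^i]$, where $C_k,C_m>0$ are the constants of the error estimates $\|u_h^{(i)}-u\|_{1,\Omega}\le C_i h^i$. Let $h^*=\left(C_k/C_m\right)^{1/(m-k)}$. Then $$\mathrm{Prob}\left\{X^{(m)}(h)\le X^{(k)}(h)\right\}=\begin{cases}1-\dfrac12\left(\dfrac{h}{h^*}\right)^{m-k} & \text{if } 0<h\le h^*,\\[3mm] \dfrac12\left(\dfrac{h^*}{h}\right)^{m-k} & \text{if } h\ge h^*.\end{cases}$$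
   Context: $\Omega\subset\mathbb{R}^n$ is open, bounded and non-empty with piecewise $C^1$ boundary. $V$ is a Hilbert space which is a usual Sobolev space on $\Omega$ (contained in $H^1(\Omega)$), $a$ is a bilinear continuous $V$-elliptic form on $V\times V$, and $l$ is a continuous linear form on $V$; the exact solution $u$ is assumed to belong to $H^{m+1}(\Omega)$. For $i\in\{k,m\}$, $u_h^{(i)}$ is the solution in $V_h^{(i)}$ of $a(u_h^{(i)},v_h)=l(v_h)$ for all $v_h\in V_h^{(i)}$, where $V_h^{(i)}\subset V$ is the finite-dimensional space of continuous functions that are polynomials of degree at most $i$ on each simplex of a mesh (from a regular family of simplicial meshes exactly covering $\Omega$) of maximal diameter $h$. The meshes used for $P_k$ and $P_m$ are produced by a mesh generator and are regarded as random. For fixed $h$, the underlying probability space consists of the possible meshes (equivalently, of the associated approximations), and $X^{(i)}(h)=\|u_h^{(i)}-u\|_{1,\Omega}$ is the $H^1(\Omega)$-norm error, viewed as a random variable; $X^{(k)}(h)$ and $X^{(m)}(h)$ are considered on a common probability space. The Bramble-Hilbert-type error estimate gives, for every mesh, $X^{(i)}(h)\le C_i h^i$ with $C_i=\mathscr{C}_i\,|u|_{i+1,\Omega}$, where $\mathscr{C}_i>0$ is independent of $h$ and $|\cdot|_{i+1,\Omega}$ is the semi-norm of $H^{i+1}(\Omega)$. *)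

(* Defs.v *)
From HB Require Import structures.
From mathcomp Require Import all_boot all_order all_algebra.
From mathcomp Require Import all_classical all_reals all_analysis.

Set Implicit Arguments.
Unset Strict Implicit.
Unset Printing Implicit Defensive.

Import Order.TTheory GRing.Theory Num.Theory.
Import numFieldNormedType.Exports.

Local Open Scope classical_set_scope.
Local Open Scope ring_scope.

(** ** Lebesgue measure on R^n

  MathComp-Analysis has Lebesgue measure on R, binary products of measures and
  the product sigma-algebra on tuples; the n-fold product is built from these
  by recursion on n. *)

Section cons_measure.
Context {R : realType} {n : nat}.

Definition tcons (p : measurableTypeR R * n.-tuple R) : n.+1.-tuple R :=
  [tuple of p.1 :: p.2].

Lemma measurable_tcons : measurable_fun [set: measurableTypeR R * n.-tuple R] tcons.
Proof. exact: measurable_cons. Qed.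

Variable mu : {sigma_finite_measure set (n.-tuple R) -> \bar R}.

Definition cons_measure : set (n.+1.-tuple R) -> \bar R :=
  pushforward (@lebesgue_measure R \x mu)%E tcons.

Let mpre A : measurable A -> measurable (tcons @^-1` A).
Proof. by move=> mA; rewrite -[X in measurable X]setTI; exact: measurable_tcons. Qed.

Let cons_measure0 : cons_measure set0 = 0%E.
Proof. by rewrite /cons_measure /pushforward preimage_set0 measure0. Qed.

Let cons_measure_ge0 A : (0 <= cons_measure A)%E.
Proof. by rewrite /cons_measure /pushforward measure_ge0. Qed.

Let cons_measure_sigma_additive : semi_sigma_additive cons_measure.
Proof.
move=> F mF tF mUF; rewrite /cons_measure /pushforward preimage_bigcup.
apply: measure_semi_sigma_additive.
- by move=> k; exact: mpre.
- apply/trivIsetP => i j _ _ ij; rewrite -preimage_setI.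
  by move/trivIsetP : tF => /(_ _ _ _ _ ij) ->//; rewrite preimage_set0.
- by rewrite -preimage_bigcup; exact: mpre.
Qed.

HB.instance Definition _ := isMeasure.Build _ _ _ cons_measure
  cons_measure0 cons_measure_ge0 cons_measure_sigma_additive.

Let cons_measure_sigma_finite : sigma_finite setT cons_measure.
Proof.
have /sigma_finiteP[F [FT ndF Foo]] := sigma_finiteT (@lebesgue_measure R).
have /sigma_finiteP[G [GT ndG Goo]] := sigma_finiteT mu.
pose g (t : n.+1.-tuple R) : measurableTypeR R * n.-tuple R :=
  (thead t, [tuple of behead t]).
have gK p : g (tcons p) = p by case: p => x t; congr pair; exact: val_inj.
have mg : measurable_fun setT g.
  apply/measurable_fun_pairP; split; last exact: measurable_behead.
  exact: measurable_tnth.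
exists (fun k => g @^-1` (F k `*` G k)).
  apply/seteqP; split=> // t _.
  have : setT (g t).1 by []. rewrite FT => -[i _ Fi].
  have : setT (g t).2 by []. rewrite GT => -[j _ Gj].
  exists (maxn i j) => //; split.
    by move: Fi; exact/subsetPset/ndF/leq_maxl.
  by move: Gj; exact/subsetPset/ndG/leq_maxr.
move=> k; have [mF Fkoo] := Foo k; have [mG Gkoo] := Goo k; split.
  by rewrite -[X in measurable X]setTI; apply: mg => //; exact: measurableX.
rewrite /cons_measure /pushforward.
rewrite (_ : tcons @^-1` _ = F k `*` G k); last first.
  by apply/seteqP; split=> p; rewrite /preimage /mkset gK.
by rewrite product_measure1E// lte_mul_pinfty// ge0_fin_numE.
Qed.

HB.instance Definition _ := Measure_isSigmaFinite.Build _ _ _ cons_measure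
  cons_measure_sigma_finite.

End cons_measure.

Fixpoint lebesgue_tuple (R : realType) (n : nat) :
    {sigma_finite_measure set (n.-tuple R) -> \bar R} :=
  if n is n'.+1 then cons_measure (lebesgue_tuple R n') else \d_[tuple].

Section sobolev.
Context {R : realType} {n : nat}.
Local Notation E := 'rV[R]_n.
Implicit Types (Omega D : set E) (f g phi u v w z : E -> R).

Definition vec (t : n.-tuple R) : E := \row_i tnth t i.

Definition integral D f : R :=
  (\int[lebesgue_tuple R n]_(t in vec @^-1` D) f (vec t))%R.

Definition L2 D f : Prop :=
  measurable_fun (vec @^-1` D) (f \o vec) /\
  (lebesgue_tuple R n).-integrable (vec @^-1` D)
    (fun t => ((f (vec t)) ^+ 2)%:E).

Definition partial (i : 'I_n) f : E -> R := 'D_(delta_mx 0 i) f.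

Definition smooth f : Prop := forall s : seq 'I_n,
  let g := foldr partial f s in
  continuous g /\ forall (i : 'I_n) x, derivable g x (delta_mx 0 i).

Definition test_function Omega phi : Prop :=
  smooth phi /\
  exists2 K : set E, compact K /\ K `<=` Omega &
    forall x, ~ K x -> phi x = 0.

Definition partials (alpha : 'I_n -> nat) f : E -> R :=
  foldr (fun i => iter (alpha i) (partial i)) f (enum 'I_n).

Definition order_of (alpha : 'I_n -> nat) : nat := (\sum_i alpha i)%N.

Definition weak_derivative Omega (alpha : 'I_n -> nat) f g : Prop :=
  forall phi, test_function Omega phi ->
    integral Omega (fun x => f x * partials alpha phi x) =
    (-1) ^+ order_of alpha * integral Omega (fun x => g x * phi x).

(** Elements of H^m(Omega) are represented by functions on R^n of which only
    the values on Omega, up to a null set, matter. *)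
Definition sobolev Omega (m : nat) : set (E -> R) :=
  [set f | L2 Omega f /\ forall alpha : 'I_n -> nat, (order_of alpha <= m)%N ->
    exists2 g, L2 Omega g & weak_derivative Omega alpha f g].

(** Some L^2 weak derivative (unique up to a null set) if there is one. *)
Definition weakD Omega (alpha : 'I_n -> nat) f : E -> R :=
  get [set g | L2 Omega g /\ weak_derivative Omega alpha f g].

(** Multi-indices of order at most m have entries at most m. *)
Definition sobolev_norm Omega (m : nat) f : R :=
  Num.sqrt (\sum_(alpha : {ffun 'I_n -> 'I_m.+1} | (order_of (fun i => alpha i) <= m)%N)
    integral Omega (fun x => weakD Omega (fun i => alpha i) f x ^+ 2)).

Definition sobolev_seminorm Omega (m : nat) f : R :=
  Num.sqrt (\sum_(alpha : {ffun 'I_n -> 'I_m.+1} | order_of (fun i => alpha i) == m)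
    integral Omega (fun x => weakD Omega (fun i => alpha i) f x ^+ 2)).

(** A closed linear subspace of H^1(Omega), hence a Hilbert space for the
    H^1 inner product: H^1(Omega), H^1_0(Omega), the functions of H^1(Omega)
    vanishing on a part of the boundary. *)
Definition sobolev_subspace Omega (V : set (E -> R)) : Prop :=
  [/\ V `<=` sobolev Omega 1,
      V (fun=> 0),
      forall c v w, V v -> V w -> V (fun x => c * v x + w x)
    & forall (v_ : nat -> E -> R) v, (forall j, V (v_ j)) -> sobolev Omega 1 v ->
        sobolev_norm Omega 1 (fun x => v_ j x - v x) @[j --> \oo] --> (0 : R) ->
        V v].

Definition continuous_linear_form Omega (V : set (E -> R))
    (l : (E -> R) -> R) : Prop :=
  (forall c v w, V v -> V w -> l (fun x => c * v x + w x) = c * l v + l w) /\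
  exists M : R, forall v, V v -> `|l v| <= M * sobolev_norm Omega 1 v.

Definition continuous_bilinear_form Omega (V : set (E -> R))
    (a : (E -> R) -> (E -> R) -> R) : Prop :=
  [/\ forall c v w z, V v -> V w -> V z ->
        a (fun x => c * v x + w x) z = c * a v z + a w z,
      forall c v w z, V v -> V w -> V z ->
        a z (fun x => c * v x + w x) = c * a z v + a z w
    & exists M : R, forall v w, V v -> V w ->
        `|a v w| <= M * sobolev_norm Omega 1 v * sobolev_norm Omega 1 w].

Definition elliptic Omega (V : set (E -> R))
    (a : (E -> R) -> (E -> R) -> R) : Prop :=
  exists2 c : R, 0 < c &
    forall v, V v -> c * sobolev_norm Omega 1 v ^+ 2 <= a v v.

Definition variational_solution (V : set (E -> R))
    (a : (E -> R) -> (E -> R) -> R) (l : (E -> R) -> R) u : Prop :=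
  V u /\ forall v, V v -> a u v = l v.

(** The boundary is a finite union of C^1-embedded closed cubes of
    dimension n - 1. *)
Definition cube : set 'rV[R]_n.-1 := [set y | forall i, 0 <= y 0 i <= 1].

Definition C1_patch (phi : 'rV[R]_n.-1 -> E) : Prop :=
  [/\ exists U : set 'rV[R]_n.-1, [/\ open U, cube `<=` U &
        forall y, U y -> differentiable phi y /\
          {for y, continuous (fun y' => 'J phi y')}],
      {in cube &, injective phi}
    & forall y, cube y -> row_free ('J phi y)].

Definition piecewise_C1_boundary Omega : Prop :=
  exists (N : nat) (phi : 'I_N -> 'rV[R]_n.-1 -> E),
    (forall j, C1_patch (phi j)) /\
    closure Omega `\` Omega° = \bigcup_j (phi j @` cube).

End sobolev.

Section finite_elements.
Context {R : realType} {n : nat}.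
Local Notation E := 'rV[R]_n.

(** An n-simplex is given by its n + 1 vertices, the rows of the matrix. *)
Definition simplex := 'M[R]_(n.+1, n).
Definition mesh := seq simplex.
Implicit Types (K L : simplex) (tau : mesh) (Omega : set E).

(** Convex hull of the vertices with index in S. *)
Definition face K (S : {set 'I_n.+1}) : set E :=
  [set x | exists2 w : 'rV[R]_n.+1,
    [/\ forall i, 0 <= w 0 i, forall i, i \notin S -> w 0 i = 0
      & \sum_i w 0 i = 1] & x = w *m K].

Definition hull K : set E := face K [set: 'I_n.+1].

Definition nondegenerate K : Prop :=
  row_free (\matrix_(i < n) (row (lift ord0 i) K - row ord0 K)).

Definition is_mesh Omega tau : Prop :=
  [/\ uniq tau,
      forall K, K \in tau -> nondegenerate K,
      closure Omega = \bigcup_(K in [set` tau]) hull K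
    & forall K L, K \in tau -> L \in tau -> K != L ->
        (hull K)° `&` (hull L)° = set0 /\
        exists S S', face K S = hull K `&` hull L /\
                     face L S' = hull K `&` hull L].

(** The norm of the library on row vectors is the sup norm. *)
Definition enorm (x : E) : R := Num.sqrt (\sum_i x 0 i ^+ 2).

Definition diameter K : R := sup [set enorm (x - y) | x in hull K & y in hull K].

Definition indiameter K : R :=
  sup [set d | exists c r, [/\ 0 <= r, d = 2 * r
    & forall x, enorm (x - c) <= r -> hull K x]].

Definition mesh_size tau : R := \big[Num.max/0]_(K <- tau) diameter K.

Definition regular_family Omega (F : set mesh) : Prop :=
  [/\ forall tau, F tau -> is_mesh Omega tau,
      exists sigma : R, forall tau K, F tau -> K \in tau ->
        diameter K <= sigma * indiameter K
    & forall e : R, 0 < e -> exists2 tau, F tau & mesh_size tau < e].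

Definition polynomial_on (k : nat) (A : set E) (v : E -> R) : Prop :=
  exists c : {ffun 'I_n -> 'I_k.+1} -> R, forall x, A x ->
    v x = \sum_(alpha : {ffun 'I_n -> 'I_k.+1} | (order_of (fun i => alpha i) <= k)%N)
            c alpha * \prod_i x 0 i ^+ alpha i.

Definition fe_space Omega (V : set (E -> R)) tau (k : nat) : set (E -> R) :=
  [set v | [/\ V v, {within closure Omega, continuous v}
    & forall K, K \in tau -> polynomial_on k (hull K) v]].

Definition fe_solution Omega (V : set (E -> R))
    (a : (E -> R) -> (E -> R) -> R) (l : (E -> R) -> R) tau (k : nat)
    (uh : E -> R) : Prop :=
  variational_solution (fe_space Omega V tau k) a l uh.

End finite_elements.
Arguments mesh : clear implicits.

Section random_variables.
Context {d : measure_display} {T : measurableType d} {R : realType}.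
Variable P : probability T R.

Definition independent (X Y : {RV P >-> R}) : Prop :=
  forall A B : set R, measurable A -> measurable B ->
    P (X @^-1` A `&` Y @^-1` B) = (P (X @^-1` A) * P (Y @^-1` B))%E.

Definition uniformly_distributed (X : {RV P >-> R}) (a b : R) : Prop :=
  exists ab : a < b, forall A : set R, measurable A ->
    distribution P X A = uniform_prob ab A.

End random_variables.
Arguments independent {d T R} P X Y.
Arguments uniformly_distributed {d T R} P X a b.

(* Main.v *)
Require Import Defs.
From HB Require Import structures.
From mathcomp Require Import all_boot all_order all_algebra.
From mathcomp Require Import all_classical all_reals all_analysis.
From mathcomp Require Import measurable_realfun ring lra.
Import Order.TTheory GRing.Theory Num.Theory.
Import numFieldNormedType.Exports.

Local Open Scope classical_set_scope.
Local Open Scope ring_scope.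

(** The errors are independent, uniform on [0, Ck h^k] and on [0, Cm h^m], so
the question is which of two such variables is the smaller.  Let X, Y be
independent, uniform on [0, a] and [0, b].  Their joint law is the product
of the two uniform laws ([probability_independent_pair]), so the
probability that Y lies below X is the mean over x in [0, a] of the
probability that Y lies below x.  If a <= b, the latter is x / b for every such
x, and the mean is a / (2 b) ([independent_uniform_below]), whether below is
meant strictly or not.  This is half the ratio of the smaller range to the
larger one.

For h >= h*, Cm h^m is the larger range and the above gives the probability of
X^(m) <= X^(k).  For h <= h* the roles are exchanged: the above gives the
probability of X^(k) < X^(m), which is the complementary event.  In both cases
the ratio of the ranges is a power of h / h*, because
h*^(m - k) = Ck / Cm. *)

Lemma independent_sym {d : measure_display} {T : measurableType d}
    {R : realType} {P : probability T R} {X Y : {RV P >-> R}} :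
  independent P X Y -> independent P Y X.
Proof. by move=> XY A B mA mB; rewrite setIC XY// muleC. Qed.

(** A joint law that factors on rectangles is a product measure, because the
rectangles generate the product sigma-algebra and are stable under
intersection.  The marginals [m1] and [m2] are arbitrary, rather than the
distributions of [X] and [Y], so that explicit laws can be substituted. *)
Lemma probability_independent_pair {d d1 d2 : measure_display}
    {T : measurableType d} {T1 : measurableType d1} {T2 : measurableType d2}
    {R : realType} {P : probability T R}
    (m1 : {sigma_finite_measure set T1 -> \bar R})
    (m2 : {sigma_finite_measure set T2 -> \bar R})
    {X : T -> T1} {Y : T -> T2} {D : set (T1 * T2)} :
  measurable_fun setT X -> measurable_fun setT Y ->
  (forall A B, measurable A -> measurable B ->
     P (X @^-1` A `&` Y @^-1` B) = (m1 A * m2 B)%E) ->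
  measurable D -> P [set w | D (X w, Y w)] = (m1 \x m2)%E D.
Proof.
move=> mX mY XY mD; pose Z w := (X w, Y w).
have mZ : measurable_fun setT Z by exact: measurable_fun_pair.
pose Zf : {mfun T >-> (T1 * T2)%type} := mfun_Sub (mem_set mZ).
by rewrite (product_measure_unique (m' := distribution P Zf)).
Qed.

(** The distribution function of the uniform law; as this law has no atoms, the
side [s] of the right bound does not affect the value. *)
Lemma uniform_prob_itvNy {R : realType} {b x : R} (b0 : 0 < b) (s : bool) :
  0 <= x <= b ->
  uniform_prob b0 [set` Interval -oo%O (BSide s x)] = (x / b)%:E.
Proof.
move=> /andP[x0 xb].
rewrite /uniform_prob integral_uniform_pdf.
rewrite (_ : _ `&` _ = [set` Interval (BLeft 0) (BSide s x)]); last first.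
  apply/seteqP; split=> y /=; rewrite !in_itv/=.
    by move=> [-> /andP[-> _]].
  move=> /andP[y0 yx]; split=> //; rewrite y0 (le_trans _ xb)//.
  by case: s yx => // /ltW.
rewrite (eq_integral (cst b^-1%:E)) => [|y /[!inE]/=]; last first.
  rewrite in_itv/= /uniform_pdf subr0 => /andP[-> yx].
  by rewrite ifT// (le_trans _ xb)//; case: s yx => // /ltW.
rewrite integral_cst//= lebesgue_measure_itv/= lte_fin -EFinD subr0.
have [_|x0'] := ltP 0 x; first by rewrite -EFinM mulrC.
by rewrite mule0 (@le_anti _ _ x 0) ?x0 ?x0'// mul0r.
Qed.

Lemma integral_itv0_id {R : realType} {a : R} : 0 < a ->
  (\int[@lebesgue_measure R]_(x in `[0%R, a]) x%:E = (a ^+ 2 / 2)%:E)%E.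
Proof.
move=> a0.
rewrite (@continuous_FTC2 _ id (fun x => x ^+ 2 / 2)) //.
- by rewrite -EFinB expr0n/= mul0r subr0.
- by apply: continuous_subspaceT => x; exact: cvg_id.
- have c : continuous (fun x : R => x ^+ 2 / 2).
    move=> x; apply: cvgM; last exact: cvg_cst.
    exact: exprn_continuous.
  split.
  + move=> x _; exact: derivableM.
  + exact/cvg_at_right_filter/c.
  + exact/cvg_at_left_filter/c.
- move=> x _; rewrite derive1E deriveM// derive_cst exp_derive scaler0 add0r.
  rewrite expr1 /GRing.scale/=; lra.
Qed.

(** The right bound [BSide s (X w)] treats the events Y < X ([s = true]) and
Y <= X ([s = false]) together: the strict one is needed when passing to the
complement of the other.  The hypothesis [a <= b] keeps the distribution
function of [Y] linear on the whole range of [X]. *)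
Lemma independent_uniform_below {d : measure_display} {T : measurableType d}
    {R : realType} {P : probability T R} {X Y : {RV P >-> R}} {a b : R}
    (s : bool) :
  independent P X Y ->
  uniformly_distributed P X 0 a -> uniformly_distributed P Y 0 b ->
  a <= b ->
  P [set w | Y w \in Interval -oo%O (BSide s (X w))] = (a / (2 * b))%:E.
Proof.
move=> XY [a0 Xu] [b0 Yu] ab.
(* The uniform law lives on [measurableTypeR R], which has the same measurable
   sets as [R] but a different display; X and Y are viewed as valued there. *)
pose R' := measurableTypeR R.
pose D : set (R' * R') := [set p | p.2 \in Interval -oo%O (BSide s p.1)].
have mD : measurable D.
  pose f (p : R' * R') := p.2 < p.1 ?<= if ~~ s.
  have mf : measurable_fun setT f.
    rewrite /f; case: s {D f} => /=.
    - by apply: measurable_fun_ltr;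
        [exact: measurable_snd | exact: measurable_fst].
    - by apply: measurable_fun_ler;
        [exact: measurable_snd | exact: measurable_fst].
  rewrite [D](_ : _ = setT `&` f @^-1` [set true]); first exact: mf.
  by rewrite setTI; apply/seteqP; split=> p; rewrite /D /preimage /mkset in_itv/=.
have mX : measurable_fun setT (X : T -> R') := measurable_funPT X.
have mY : measurable_fun setT (Y : T -> R') := measurable_funPT Y.
rewrite -[LHS]/(P [set w | D (X w, Y w)]).
rewrite (probability_independent_pair (uniform_prob a0) (uniform_prob b0) mX mY)//;
  last first.
  move=> A B mA mB; rewrite -[LHS]/(P (X @^-1` A `&` Y @^-1` B)) XY//.
  by congr (_ * _)%E; [exact: Xu | exact: Yu].
have mU := measurable_fun_xsection (uniform_prob b0) mD.
rewrite /product_measure1 integral_uniform// subr0.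
rewrite (eq_integral (fun x : R' => b^-1%:E * x%:E)%E); last first.
  move=> x /[!inE]/=; rewrite in_itv/= => /andP[x0 xa].
  rewrite -EFinM mulrC -(uniform_prob_itvNy b0 s) ?x0 ?(le_trans xa)//.
  by congr uniform_prob; rewrite xsectionE.
rewrite ge0_integralZl//=; last 2 first.
- by move=> x; rewrite in_itv/= lee_fin => /andP[].
- by rewrite lee_fin invr_ge0 ltW.
rewrite integral_itv0_id// -!EFinM; congr EFin.
by field; rewrite ?lt0r_neq0.
Qed.

Lemma powR_invn_exprn {R : realType} {x : R} {n : nat} :
  0 <= x -> (0 < n)%N -> (x `^ n%:R^-1) ^+ n = x.
Proof.
move=> x0 n0; rewrite -powR_mulrn ?powR_ge0// -powRrM mulVf ?powRr1//.
by rewrite pnatr_eq0 -lt0n.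
Qed.

Theorem theorem3p3 (R : realType) (n : nat) (Omega : set 'rV[R]_n)
    (V : set ('rV[R]_n -> R)) (a : ('rV[R]_n -> R) -> ('rV[R]_n -> R) -> R)
    (l : ('rV[R]_n -> R) -> R) (u : 'rV[R]_n -> R)
    (k m : nat) (F : set (mesh R n)) (uh : nat -> mesh R n -> 'rV[R]_n -> R)
    (scrC C : nat -> R) (h : R)
    (d : measure_display) (T : measurableType d) (P : probability T R)
    (M : nat -> T -> mesh R n) (X : nat -> {RV P >-> R}) :
  (0 < n)%N -> open Omega -> bounded_set Omega -> Omega !=set0 ->
  piecewise_C1_boundary Omega ->
  sobolev_subspace Omega V ->
  continuous_bilinear_form Omega V a -> elliptic Omega V a ->
  continuous_linear_form Omega V l ->
  (0 < k < m)%N ->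
  variational_solution V a l u -> sobolev Omega m.+1 u ->
  regular_family Omega F ->
  (forall i, i \in [:: k; m] -> forall tau, F tau ->
     fe_solution Omega V a l tau i (uh i tau)) ->
  (forall i, i \in [:: k; m] ->
     [/\ 0 < scrC i, C i = scrC i * sobolev_seminorm Omega i.+1 u, 0 < C i
       & forall tau, F tau ->
           sobolev_norm Omega 1 (fun x => uh i tau x - u x)
             <= C i * mesh_size tau ^+ i]) ->
  0 < h ->
  (forall i, i \in [:: k; m] -> forall omega,
     [/\ F (M i omega), mesh_size (M i omega) = h
       & X i omega =
           sobolev_norm Omega 1 (fun x => uh i (M i omega) x - u x)]) ->
  independent P (X k) (X m) ->
  (forall i, i \in [:: k; m] ->
     uniformly_distributed P (X i) 0 (C i * h ^+ i)) ->
  let hstar := (C k / C m) `^ ((m - k)%:R^-1) in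
  (h <= hstar ->
     P [set omega | X m omega <= X k omega] =
       (1 - 2^-1 * (h / hstar) ^+ (m - k))%:E) /\
  (hstar <= h ->
     P [set omega | X m omega <= X k omega] =
       (2^-1 * (hstar / h) ^+ (m - k))%:E).
Proof.
move=> _ _ _ _ _ _ _ _ _ /andP[_ km] _ _ _ _ est h0 _ XkXm unif hstar.
have kS : k \in [:: k; m] by rewrite inE eqxx.
have mS : m \in [:: k; m] by rewrite !inE eqxx orbT.
have [_ _ Ck0 _] := est k kS.
have [_ _ Cm0 _] := est m mS.
have r0 : 0 < C k / C m by exact: divr_gt0.
have hs0 : 0 < hstar by exact: powR_gt0.
have hsE : hstar ^+ (m - k) = C k / C m.
  by apply: powR_invn_exprn; [exact: ltW | rewrite subn_gt0].
have mk0 : (0 < m - k)%N by rewrite subn_gt0.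
have hmE : h ^+ m = h ^+ k * h ^+ (m - k) by rewrite -exprD subnKC// ltnW.
have hk0 : 0 < h ^+ k by exact: exprn_gt0.
have hd0 : 0 < h ^+ (m - k) by exact: exprn_gt0.
have rangesE : (C k * h ^+ k <= C m * h ^+ m) = (hstar <= h).
  rewrite -(@ler_pXn2r _ _ mk0 hstar) ?nnegrE ?(ltW hs0) ?(ltW h0)// hsE ler_pdivrMr// hmE.
  by rewrite mulrCA [C k * _]mulrC ler_pM2l// mulrC.
have rangesE' : (C m * h ^+ m <= C k * h ^+ k) = (h <= hstar).
  rewrite -(@ler_pXn2r _ _ mk0 h) ?nnegrE ?(ltW hs0) ?(ltW h0)// hsE ler_pdivlMr// hmE.
  by rewrite mulrCA [C k * _]mulrC ler_pM2l// mulrC.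
split=> hh.
- have XltE : P [set w | X k w < X m w] = (2^-1 * (h / hstar) ^+ (m - k))%:E.
    have := independent_uniform_below true (independent_sym XkXm)
      (unif m mS) (unif k kS).
    rewrite rangesE' => /(_ hh).
    under eq_set do rewrite in_itv/=.
    move=> ->; congr EFin; rewrite expr_div_n hsE hmE.
    by field; rewrite ?lt0r_neq0.
  rewrite [X in P X](_ : _ = ~` [set w | X k w < X m w]); last first.
    by apply/seteqP; split=> w /=; rewrite leNgt => /negP.
  rewrite probability_setC ?XltE//.
  rewrite -[X in measurable X]setTI.
  have mlt : measurable_fun setT (fun w => X k w < X m w).
    exact: measurable_fun_ltr.
  exact: (mlt measurableT [set true]).
- have := independent_uniform_below false XkXm (unif k kS) (unif m mS).
  rewrite rangesE => /(_ hh).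
  under eq_set do rewrite in_itv/=.
  move=> ->; congr EFin; rewrite expr_div_n hsE hmE.
  by field; rewrite ?lt0r_neq0.
Qed.
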